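(* A connected graph $G$ is finitely separable if and only if it has a finitely separating spanning tree.
   Context: Two vertices of a graph $G$ are finitely separable if some finite set of edges of $G$ separates them in $G$; $G$ is finitely separable if every pair of its vertices is finitely separable. A spanning tree $T$ of $G$ is finitely separating if all its fundamental cuts are finite, i.e. for every edge $e\in E(T)$ with $T_1,T_2$ the components of $T-e$, the set $E_G(V(T_1),V(T_2))$ of edges of $G$ between $V(T_1)$ and $V(T_2)$ is finite. *)

(* Defs.v *)
From Stdlib Require Import List Relations.
Import ListNotations.

Record graph := Graph {
  vert : Type;
  adj : vert -> vert -> Prop;
  adj_sym : forall x y, adj x y -> adj y x;
  adj_irrefl : forall x, ~ adj x x
}.

Section G.
Variable G : graph.
Notation V := (vert G).

Definition connected_rel (r : V -> V -> Prop) : Prop :=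
  forall u v : V, clos_refl_trans V r u v.

Definition connected : Prop := connected_rel (adj G).

(* A finite set of edges is represented by a finite list of (ordered) pairs;
   the unordered edge {a,b} belongs to F if (a,b) or (b,a) is in the list. *)
Definition edge_in (F : list (V * V)) (a b : V) : Prop :=
  In (a, b) F \/ In (b, a) F.

Definition adj_minus (F : list (V * V)) (a b : V) : Prop :=
  adj G a b /\ ~ edge_in F a b.

Definition separates (F : list (V * V)) (u v : V) : Prop :=
  ~ clos_refl_trans V (adj_minus F) u v.

Definition finitely_separable_pair (u v : V) : Prop :=
  exists F : list (V * V), separates F u v.

Definition finitely_separable : Prop :=
  forall u v : V, u <> v -> finitely_separable_pair u v.

Fixpoint rpath (r : V -> V -> Prop) (x : V) (l : list V) : Prop :=
  match l with
  | [] => True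
  | y :: l' => r x y /\ rpath r y l'
  end.

Definition has_cycle (r : V -> V -> Prop) : Prop :=
  exists (x : V) (l : list V),
    2 <= length l /\ NoDup (x :: l) /\ rpath r x l /\ r (last l x) x.

Definition spanning_tree (t : V -> V -> Prop) : Prop :=
  (forall a b, t a b -> t b a) /\
  (forall a b, t a b -> adj G a b) /\
  connected_rel t /\
  ~ has_cycle t.

Definition tree_minus (t : V -> V -> Prop) (x y a b : V) : Prop :=
  t a b /\ ~ ((a = x /\ b = y) \/ (a = y /\ b = x)).

(* the set E_G(V(T1),V(T2)) is finite, where T1, T2 are the components of
   T - e containing x and y respectively *)
Definition finite_fundamental_cut (t : V -> V -> Prop) (x y : V) : Prop :=
  exists L : list (V * V),
    forall a b : V,
      adj G a b ->
      clos_refl_trans V (tree_minus t x y) x a ->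
      clos_refl_trans V (tree_minus t x y) y b ->
      In (a, b) L.

Definition finitely_separating (t : V -> V -> Prop) : Prop :=
  forall x y : V, t x y -> finite_fundamental_cut t x y.

End G.

(* Main.v *)
(** A tree edge [xy] is controlled by a finite cut of [G] which it is the only
    tree edge to cross; such cuts forbid cycles and bound fundamental cuts.
    Grow a tree with vertex set [X] together with a partition of [V(G)] into
    connected classes, one for each vertex of [X], such that only finitely many
    edges of [G] run between different classes without lying inside [X].  Any
    vertex [w] in the class of [x] can be absorbed: take a path from [x] to [w]
    in the class, split the class along a finite cut separating [x] from the
    rest of the path, add the first edge, and continue in the new class.
    Absorbing the ends of these exceptional edges, and repeating this [omega]
    times, yields a tree with no exceptional edges.  Unions of chains of such
    closed trees are closed again, so Zorn's lemma gives a maximal one, and by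
    the absorption step it must span [G].  No countability is needed.

    Conversely, if [t] is a finitely separating spanning tree, then the
    fundamental cut of the first edge on the [t]-path from [u] to [v]
    separates [u] from [v]. *)

Require Import Defs.
From Stdlib Require Import List Relations.
From Stdlib Require Import Classical ClassicalEpsilon Lia.
From mathcomp Require classical_sets.
Import ListNotations.

(** * Reachability and simple paths *)

Section Paths.
Variable G : graph.
Notation V := (vert G).

Lemma clos_rt_mono (r r' : V -> V -> Prop) (u v : V) :
  (forall a b, r a b -> r' a b) ->
  clos_refl_trans V r u v -> clos_refl_trans V r' u v.
Proof.
  intros H; induction 1; [apply rt_step; auto | apply rt_refl | eapply rt_trans; eauto].
Qed.

Lemma clos_rt_sym (r : V -> V -> Prop) (u v : V) :
  (forall a b, r a b -> r b a) ->
  clos_refl_trans V r u v -> clos_refl_trans V r v u.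
Proof.
  intros H; induction 1; [apply rt_step; auto | apply rt_refl | eapply rt_trans; eauto].
Qed.

Lemma clos_rt_invariant (r : V -> V -> Prop) (S : V -> Prop) (u v : V) :
  (forall a b, r a b -> S a -> S b) ->
  clos_refl_trans V r u v -> S u -> S v.
Proof. intros H; induction 1; eauto. Qed.

(** Every vertex on a walk from [u] is itself reachable from [u], so only steps between such
    vertices need converting. *)
Lemma clos_rt_along (r r' : V -> V -> Prop) (u v : V) :
  (forall a b, clos_refl_trans V r u a -> clos_refl_trans V r u b ->
     r a b -> r' a b) ->
  clos_refl_trans V r u v -> clos_refl_trans V r' u v.
Proof.
  intros H Huv; apply clos_rt_rtn1 in Huv; induction Huv as [|y z Hyz Huy IH].
  - apply rt_refl.
  - apply clos_rtn1_rt in Huy.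
    eapply rt_trans; [exact IH | apply rt_step, H; auto].
    eapply rt_trans; [exact Huy | now apply rt_step].
Qed.

Lemma last_cons (x y : V) (l : list V) : last (y :: l) x = last l y.
Proof.
  revert x y; induction l as [|z l IH]; intros x y; [reflexivity|].
  change (last (z :: l) x = last (z :: l) y); now rewrite !IH.
Qed.

Lemma rpath_suffix (r : V -> V -> Prop) (x : V) (l : list V) :
  forall z, In x (z :: l) -> rpath G r z l -> NoDup (z :: l) ->
  exists l', rpath G r x l' /\ last l' x = last l z /\ NoDup (x :: l').
Proof.
  induction l as [|y l IH]; intros z Hin Hp Hnd.
  - destruct Hin as [->|[]]; exists []; auto.
  - destruct Hin as [->|Hin]; [exists (y :: l); auto|].
    destruct Hp as [_ Hp]; apply NoDup_cons_iff in Hnd as [_ Hnd].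
    rewrite last_cons; auto.
Qed.

Lemma clos_rt_simple_path (r : V -> V -> Prop) (x y : V) :
  clos_refl_trans V r x y ->
  exists l, rpath G r x l /\ last l x = y /\ NoDup (x :: l).
Proof.
  intros H; apply clos_rt_rt1n in H; induction H as [x|x z y Hxz _ IH].
  - exists []; repeat split; constructor; auto; constructor.
  - destruct IH as (l & Hp & Hl & Hnd).
    destruct (classic (In x (z :: l))) as [Hin|Hin].
    + destruct (rpath_suffix r x l z Hin Hp Hnd) as (l' & H1 & H2 & H3).
      exists l'; subst; auto.
    + exists (z :: l); rewrite last_cons; repeat split; auto; now constructor.
Qed.

Lemma rpath_clos_rt (r : V -> V -> Prop) (l : list V) :
  forall x, rpath G r x l -> clos_refl_trans V r x (last l x).
Proof.
  induction l as [|y l IH]; intros x Hp; [apply rt_refl|].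
  rewrite last_cons; destruct Hp; eapply rt_trans; [apply rt_step|]; eauto.
Qed.

Lemma rpath_mono (r r' : V -> V -> Prop) (l : list V) :
  forall x,
  (forall a b, In a (x :: l) -> In b l -> r a b -> r' a b) ->
  rpath G r x l -> rpath G r' x l.
Proof.
  induction l as [|y l IH]; simpl; intros x H Hp; [trivial|].
  destruct Hp as [Hxy Hp]; split; [apply H; auto|].
  apply IH; [|exact Hp]; intros a b Ha Hb; apply H; simpl in *; tauto.
Qed.

Lemma rpath_crossing (r : V -> V -> Prop) (S : V -> Prop) (l : list V) :
  forall x, rpath G r x l -> ~ S x -> S (last l x) ->
  exists a b, In a (x :: l) /\ r a b /\ ~ S a /\ S b.
Proof.
  induction l as [|y l IH]; intros x Hp Hx Hy; [contradiction|].
  rewrite last_cons in Hy; destruct Hp as [Hxy Hp].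
  destruct (classic (S y)) as [Sy|Sy].
  - exists x, y; simpl; auto.
  - destruct (IH y Hp Sy Hy) as (a & b & Ha & Hr).
    exists a, b; split; [right|]; auto.
Qed.

Lemma rpath_in_invariant (r : V -> V -> Prop) (S : V -> Prop) (l : list V) :
  forall x, (forall a b, r a b -> S a -> S b) -> S x -> rpath G r x l ->
  forall p, In p l -> S p.
Proof.
  induction l as [|y l IH]; simpl; intros x Hr Hx Hp p Hin; [contradiction|].
  destruct Hp as [Hxy Hp]; destruct Hin as [<-|Hin]; eauto.
Qed.

End Paths.

(** * Finitely separating trees give finite separability *)

Lemma tree_minus_disconnects (G : graph) (t : vert G -> vert G -> Prop) (x y : vert G) :
  spanning_tree G t -> t x y ->
  ~ clos_refl_trans (vert G) (tree_minus G t x y) x y.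
Proof.
  intros (Hsym & Hadj & _ & Hac) Hxy Hc.
  destruct (clos_rt_simple_path G _ _ _ Hc) as (l & Hp & Hl & Hnd).
  apply Hac; exists x, l; repeat split; auto.
  (* Length 0 would make the edge [xy] a loop; length 1 would use the deleted edge itself. *)
  - destruct l as [|z [|w l]]; simpl in *; [| |lia].
    + subst; exfalso; exact (adj_irrefl G y (Hadj _ _ Hxy)).
    + subst; exfalso; destruct Hp as [[_ Hn] _]; apply Hn; auto.
  - eapply rpath_mono; [|exact Hp]; intros a b _ _ [H _]; exact H.
  - rewrite Hl; auto.
Qed.

Lemma finitely_separating_separable (G : graph) (t : vert G -> vert G -> Prop) :
  spanning_tree G t -> finitely_separating G t -> finitely_separable G.
Proof.
  intros Ht Hf u v Huv.
  pose proof Ht as (Hsym & Hadj & Hcon & _).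
  destruct (clos_rt_simple_path G t u v (Hcon u v)) as ([|x l] & Hp & Hl & Hnd).
  { simpl in Hl; contradiction. }
  rewrite last_cons in Hl; destruct Hp as [Hux Hp].
  assert (Htsym : forall a b, tree_minus G t u x a b -> tree_minus G t u x b a).
  { intros a b [H1 H2]; split; [auto|tauto]. }
  (* The path is simple, so once it has left [u] it never uses the edge [ux] again. *)
  assert (Hxv : clos_refl_trans (vert G) (tree_minus G t u x) x v).
  { rewrite <- Hl; apply rpath_clos_rt; eapply rpath_mono; [|exact Hp].
    apply NoDup_cons_iff in Hnd as [Hu _].
    intros a b Ha Hb Hab; split; [exact Hab|].
    intros [[-> _]|[_ ->]]; [auto|apply Hu; right; auto]. }
  destruct (Hf u x Hux) as [L HL].
  exists L; intros Hsep.
  assert (Huv' : clos_refl_trans (vert G) (tree_minus G t u x) u v).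
  { refine (clos_rt_invariant G _ (fun w => clos_refl_trans (vert G) (tree_minus G t u x) u w)
              _ _ _ Hsep (rt_refl _ _ _)).
    (* Deleting [ux] leaves only the components of [u] and [x], so an edge of [G] leaving the former
       enters the latter and is listed in [L]. *)
    intros a b [Hab HnL] Ha; apply NNPP; intros Hb; apply HnL; left; apply HL; auto.
    assert (Hor : clos_refl_trans (vert G) (tree_minus G t u x) u b \/
                  clos_refl_trans (vert G) (tree_minus G t u x) x b); [|tauto].
    refine (clos_rt_invariant G t (fun w => clos_refl_trans (vert G) (tree_minus G t u x) u w \/
              clos_refl_trans (vert G) (tree_minus G t u x) x w) _ _ _ (Hcon u b)
              (or_introl (rt_refl _ _ _))).
    intros p q Hpq Hor.
    destruct (classic (tree_minus G t u x p q)) as [Hm|Hm].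
    - destruct Hor; [left|right]; eapply rt_trans; eauto; now apply rt_step.
    - assert (E : (p = u /\ q = x) \/ (p = x /\ q = u)).
      { apply NNPP; intros E; apply Hm; split; auto. }
      destruct E as [[_ ->]|[_ ->]]; [right|left]; apply rt_refl. }
  apply (tree_minus_disconnects G t u x Ht Hux).
  eapply rt_trans; [exact Huv'|apply clos_rt_sym; auto].
Qed.

(** * Partial trees and their order *)

(* The tree lives on the fixed points of [pt_rep], and [pt_rep w] names the
   class of [w].  [pt_pending] is the finite set of edges between classes that
   are not yet inside the tree's vertex set.  The cut in [pt_cut] is a union of
   classes, so that it survives any later refinement inside the classes. *)
Record partial_tree (G : graph) (r : vert G) := PartialTree {
  pt_edge : vert G -> vert G -> Prop;
  pt_rep : vert G -> vert G;
  pt_pending : list (vert G * vert G);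
  pt_sym : forall a b, pt_edge a b -> pt_edge b a;
  pt_adj : forall a b, pt_edge a b -> adj G a b;
  pt_fix : forall a b, pt_edge a b -> pt_rep a = a;
  pt_root : pt_rep r = r;
  pt_conn : forall w, pt_rep w = w -> clos_refl_trans (vert G) pt_edge r w;
  pt_idem : forall w, pt_rep (pt_rep w) = pt_rep w;
  pt_class : forall w,
    clos_refl_trans (vert G) (fun a b => adj G a b /\ pt_rep a = pt_rep b) w (pt_rep w);
  pt_cross : forall a b, adj G a b -> pt_rep a <> pt_rep b ->
    (pt_rep a = a /\ pt_rep b = b) \/ In (a, b) pt_pending;
  pt_cut : forall x y, pt_edge x y ->
    exists (S : vert G -> Prop) (K : list (vert G * vert G)),
      S x /\ ~ S y /\
      (forall a b, pt_rep a = pt_rep b -> S a -> S b) /\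
      (forall a b, adj G a b -> S a -> ~ S b -> In (a, b) K) /\
      (forall a b, pt_edge a b -> S a -> ~ S b -> a = x /\ b = y)
}.

Arguments pt_edge {G r}.
Arguments pt_rep {G r}.
Arguments pt_pending {G r}.

Section PartialTrees.
Variables (G : graph) (r : vert G).
Notation V := (vert G).
Notation ptree := (partial_tree G r).

(** By the last clause new edges stay inside old classes, so they never cross an old cut, which is a
    union of such classes. *)
Definition pt_le (s s' : ptree) : Prop :=
  (forall a b, pt_edge s a b -> pt_edge s' a b) /\
  (forall w, pt_rep s w = w -> pt_rep s' w = w) /\
  (forall a b, pt_rep s' a = pt_rep s' b -> pt_rep s a = pt_rep s b) /\
  (forall a b, pt_edge s' a b -> pt_edge s a b \/ pt_rep s a = pt_rep s b).

Lemma pt_le_refl (s : ptree) : pt_le s s.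
Proof. repeat split; auto. Qed.

Lemma pt_le_trans (s1 s2 s3 : ptree) : pt_le s1 s2 -> pt_le s2 s3 -> pt_le s1 s3.
Proof.
  intros (A1 & A2 & A3 & A4) (B1 & B2 & B3 & B4); repeat split; auto.
  intros a b H; destruct (B4 a b H); auto.
Qed.

Lemma pt_edge_rep_fixed (s : ptree) (w : V) :
  clos_refl_trans V (pt_edge s) r w -> pt_rep s w = w.
Proof.
  intros H; refine (clos_rt_invariant G _ (fun w => pt_rep s w = w) _ _ _ H (pt_root G r s)).
  intros a b Hab _; exact (pt_fix G r s b a (pt_sym G r s a b Hab)).
Qed.

Lemma separate_from_list (x : V) (l : list V) :
  finitely_separable G -> (forall p, In p l -> p <> x) ->
  exists F, forall p, In p l -> separates G F x p.
Proof.
  intros Hfs; induction l as [|q l IH]; intros Hl.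
  - exists []; intros p [].
  - destruct IH as [F HF]; [intros; apply Hl; right; auto|].
    destruct (Hfs x q) as [F' HF']; [intros E; apply (Hl q); [left|]; auto|].
    exists (F ++ F'); intros p Hp Hc.
    destruct Hp as [<-|Hp]; [apply HF'|apply (HF p Hp)];
      (eapply clos_rt_mono; [|exact Hc]); intros a b [Hab Hn]; split; auto;
      intros He; apply Hn; unfold edge_in in *; rewrite !in_app_iff; tauto.
Qed.

(** * Splitting a class along a finite cut *)

Section Split.
Variables (s : ptree) (x p : V) (l : list V) (F : list (V * V)).
Notation c := (pt_rep s).
Hypothesis Hx : c x = x.
Hypothesis Hxp : adj G x p.
Hypothesis Hpath : rpath G (adj G) p l.
Hypothesis Hin : forall q, In q (p :: l) -> c q = x.
Hypothesis HF : forall q, In q (p :: l) -> separates G F x q.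

(* [near] is the part of the class of [x] still reachable from [x] after
   deleting [F]; [far], the component of [p] in the rest of the class, becomes
   the new class.  Both resulting classes are connected since every other
   component of the rest is attached to [near]. *)
Definition near (w : V) : Prop :=
  clos_refl_trans V (fun a b => adj_minus G F a b /\ c a = x /\ c b = x) x w.

Definition far (w : V) : Prop :=
  clos_refl_trans V
    (fun a b => adj G a b /\ (c a = x /\ ~ near a) /\ (c b = x /\ ~ near b)) p w.

Lemma path_not_near (q : V) : In q (p :: l) -> ~ near q.
Proof.
  intros Hq Hn; apply (HF q Hq); eapply clos_rt_mono; [|exact Hn]; intros a b; tauto.
Qed.

Lemma far_spec (w : V) : far w -> c w = x /\ ~ near w.
Proof.
  intros H; refine (clos_rt_invariant G _ (fun w => c w = x /\ ~ near w) _ _ _ H _);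
    [intros a b; tauto|].
  split; [apply Hin|apply path_not_near]; left; auto.
Qed.

Lemma far_step (a b : V) : far a -> adj G a b -> c b = x -> ~ near b -> far b.
Proof.
  intros Ha Hab Hb Hn; pose proof (far_spec a Ha).
  eapply rt_trans; [exact Ha|apply rt_step; tauto].
Qed.

Lemma far_path (q : V) : In q (p :: l) -> far q.
Proof.
  intros [<-|Hq]; [apply rt_refl|].
  assert (Hp' : rpath G (fun a b => adj G a b /\ c b = x /\ ~ near b) p l).
  { eapply rpath_mono; [|exact Hpath]; intros a b _ Hb Hab; split; auto.
    split; [apply Hin|apply path_not_near]; right; auto. }
  refine (rpath_in_invariant G _ far l p _ (rt_refl _ _ _) Hp' q Hq).
  intros a b (H1 & H2 & H3) Ha; eapply far_step; eauto.
Qed.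

Lemma far_p : far p.
Proof. apply rt_refl. Qed.

Lemma rep_p : c p = x.
Proof. apply Hin; left; auto. Qed.

Lemma x_neq_p : x <> p.
Proof. intros E; apply (adj_irrefl G p); rewrite <- E at 1; exact Hxp. Qed.

Lemma not_far_x : ~ far x.
Proof. intros H; destruct (far_spec x H) as [_ H']; apply H', rt_refl. Qed.

(** [x] is the only fixed vertex of its class, and it is near. *)
Lemma not_far_fixed (w : V) : c w = w -> ~ far w.
Proof.
  intros Hw H; destruct (far_spec w H) as [H' _]; apply not_far_x.
  rewrite Hw in H'; now subst.
Qed.

Definition split_rep (w : V) : V :=
  if excluded_middle_informative (far w) then p else c w.

Lemma split_rep_far (w : V) : far w -> split_rep w = p.
Proof. unfold split_rep; destruct (excluded_middle_informative (far w)); tauto. Qed.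

Lemma split_rep_not_far (w : V) : ~ far w -> split_rep w = c w.
Proof. unfold split_rep; destruct (excluded_middle_informative (far w)); tauto. Qed.

Lemma split_rep_fixed (w : V) : c w = w -> split_rep w = w.
Proof. intros H; rewrite split_rep_not_far; auto using not_far_fixed. Qed.

Lemma rep_neq_p (w : V) : c w <> p.
Proof.
  intros E; apply x_neq_p; rewrite <- rep_p, <- E at 1; now rewrite pt_idem.
Qed.

Lemma split_rep_refines (a b : V) : split_rep a = split_rep b -> c a = c b.
Proof.
  destruct (classic (far a)) as [Ha|Ha], (classic (far b)) as [Hb|Hb]; intros E.
  - destruct (far_spec a Ha), (far_spec b Hb); congruence.
  - rewrite (split_rep_far a Ha), (split_rep_not_far b Hb) in E.
    now destruct (rep_neq_p b).
  - rewrite (split_rep_not_far a Ha), (split_rep_far b Hb) in E.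
    now destruct (rep_neq_p a).
  - now rewrite !split_rep_not_far in E.
Qed.

Lemma split_rep_far_iff (a b : V) : split_rep a = split_rep b -> far a -> far b.
Proof.
  intros E Ha; apply NNPP; intros Hb.
  rewrite split_rep_far, split_rep_not_far in E; auto; now destruct (rep_neq_p b).
Qed.

(** [F] enters in both orientations: pending pairs are ordered, whereas [F] stands for unordered
    edges. *)
Definition split_pending : list (V * V) :=
  pt_pending s ++ F ++ map (fun e => (snd e, fst e)) F.

Lemma split_pending_edge (a b : V) :
  edge_in G F a b -> In (a, b) split_pending /\ In (b, a) split_pending.
Proof.
  unfold split_pending; rewrite !in_app_iff; intros [H|H];
    pose proof (in_map (fun e => (snd e, fst e)) _ _ H); simpl in *; tauto.
Qed.

(* Inside the class of [x], an edge leaving [far] can only end in [near], so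
   it belongs to [F]; any other edge leaving [far] was already pending, since
   [far] contains no fixed vertex. *)
Lemma far_boundary (a b : V) :
  adj G a b -> far a -> ~ far b ->
  In (a, b) split_pending /\ In (b, a) split_pending.
Proof.
  intros Hab Ha Hb; destruct (far_spec a Ha) as [Hca Hna].
  destruct (classic (c b = x)) as [Hcb|Hcb].
  - apply split_pending_edge; apply NNPP; intros HnF.
    apply Hb, (far_step a); auto; intros Hnb; apply Hna.
    eapply rt_trans; [exact Hnb|apply rt_step]; repeat split; auto using adj_sym.
    intros [H|H]; apply HnF; [right|left]; auto.
  - assert (Hfix : c a <> a) by (intros E; exact (not_far_fixed a E Ha)).
    unfold split_pending; rewrite !in_app_iff.
    destruct (pt_cross G r s a b Hab) as [[E _]|E]; [congruence|contradiction|].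
    destruct (pt_cross G r s b a (adj_sym G a b Hab)) as [[_ E']|E'];
      [congruence|contradiction|]; auto.
Qed.

Definition split_edge (a b : V) : Prop :=
  pt_edge s a b \/ (a = x /\ b = p) \/ (a = p /\ b = x).

(** For [w] outside [far], the walk to the old representative still serves unless it enters [far].
    This can happen only in the class of [x], and there a detour through [near] replaces it. *)
Lemma split_class (w : V) :
  clos_refl_trans V (fun a b => adj G a b /\ split_rep a = split_rep b) w (split_rep w).
Proof.
  destruct (classic (far w)) as [Hw|Hw].
  - rewrite (split_rep_far w) by auto.
    apply clos_rt_sym; [intros a b []; split; auto using adj_sym|].
    eapply clos_rt_along; [|exact Hw]; intros a b Ha Hb (H & _); split; auto.
    now rewrite !split_rep_far.
  - rewrite (split_rep_not_far w) by auto.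
    pose proof (pt_class G r s w) as Hcl.
    destruct (classic (c w = x)) as [Hcw|Hcw].
    + apply clos_rt_rt1n in Hcl; rewrite Hcw in *.
      remember x as z eqn:Ez in Hcl.
      induction Hcl as [w|w w1 z [Hadj E] _ IH]; [subst; apply rt_refl|].
      rewrite <- Ez.
      destruct (classic (far w1)) as [Hf|Hf].
      (* A neighbour of [far] in the class of [x] but outside [far] is near, and the walk witnessing
         this misses [far]. *)
      * assert (Hn : near w).
        { apply NNPP; intros Hn; apply Hw, (far_step w1); auto using adj_sym. }
        apply clos_rt_sym; [intros a b []; split; auto using adj_sym|].
        rewrite Ez; eapply clos_rt_along; [|exact Hn].
        intros a b Ha Hb ((H & _) & H1 & H2); split; auto.
        assert (Hnf : forall q, near q -> ~ far q)
          by (intros q Hq Hq'; destruct (far_spec q Hq'); auto).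
        rewrite !split_rep_not_far by (apply Hnf; auto); congruence.
      * eapply rt_trans; [apply rt_step; split; [exact Hadj|]|].
        { rewrite !split_rep_not_far; auto. }
        rewrite Ez in *; apply IH; auto; congruence.
    + eapply clos_rt_along; [|exact Hcl]; intros a b Ha Hb (H & E); split; auto.
      assert (Hc : forall q, clos_refl_trans V (fun a b => adj G a b /\ c a = c b) w q ->
                     ~ far q).
      { intros q Hq Hf; apply Hcw; destruct (far_spec q Hf) as [<- _].
        refine (clos_rt_invariant G _ (fun q => c w = c q) _ _ _ Hq eq_refl).
        intros u v [_ Huv] Hu; congruence. }
      rewrite !split_rep_not_far; auto.
Qed.

Definition split_tree : ptree.
Proof.
  refine (PartialTree G r split_edge split_rep split_pending _ _ _ _ _ _ split_class _ _).
  - intros a b [H|H]; [left; now apply pt_sym|right; tauto].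
  - intros a b [H|[[-> ->]|[-> ->]]]; [eapply pt_adj; eauto|auto|auto using adj_sym].
  - intros a b [H|[[-> ->]|[-> ->]]].
    + apply split_rep_fixed; eapply pt_fix; eauto.
    + now apply split_rep_fixed.
    + apply split_rep_far, far_p.
  - apply split_rep_fixed, pt_root.
  - assert (Hold : forall w, c w = w -> clos_refl_trans V split_edge r w).
    { intros w Hw; eapply clos_rt_mono; [|apply (pt_conn G r s w Hw)]; left; auto. }
    intros w Hw; destruct (classic (far w)) as [Hf|Hf].
    + rewrite split_rep_far in Hw by auto; subst w.
      eapply rt_trans; [apply (Hold x Hx)|apply rt_step; right; auto].
    + rewrite split_rep_not_far in Hw by auto; auto.
  - intros w; destruct (classic (far w)) as [Hf|Hf].
    + rewrite (split_rep_far w) by auto; apply split_rep_far, far_p.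
    + rewrite (split_rep_not_far w) by auto; apply split_rep_fixed, pt_idem.
  - intros a b Hab E.
    destruct (classic (far a)) as [Ha|Ha], (classic (far b)) as [Hb|Hb].
    + destruct E; now rewrite !split_rep_far.
    + right; apply (far_boundary a b); auto.
    + right; apply (far_boundary b a); auto using adj_sym.
    + rewrite !split_rep_not_far in * by auto.
      destruct (pt_cross G r s a b Hab E); [auto|right; apply in_or_app; auto].
  (* Both ends of an old tree edge are fixed, hence outside [far]. *)
  - assert (Hnf : forall a b, pt_edge s a b -> ~ far a /\ ~ far b).
    { intros a b H; split; apply not_far_fixed;
        [apply (pt_fix G r s a b H)|apply (pt_fix G r s b a), pt_sym, H]. }
    intros u v [H|[[-> ->]|[-> ->]]].
    (* Old cuts persist: [x] and [p] share an old class, so the new edge crosses none of them. *)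
    + destruct (pt_cut G r s u v H) as (S & K & H1 & H2 & H3 & H4 & H5).
      exists S, K; split; [auto|split; [auto|split; [|split; [auto|]]]].
      * intros a b E; apply H3; now apply split_rep_refines.
      * intros a b [Hab|[[-> ->]|[-> ->]]] Ha Hb; [auto| |];
          destruct Hb; revert Ha; apply H3; rewrite rep_p; auto.
    (* The new edge is the only tree edge on the boundary of [far], and [split_pending] contains
       that whole boundary. *)
    + exists (fun w => ~ far w), split_pending; split; [apply not_far_x|].
      split; [intros H; apply H, far_p|split; [|split]].
      * intros a b E Ha Hb; apply Ha; eapply split_rep_far_iff; [symmetry|]; eauto.
      * intros a b Hab Ha Hb; apply NNPP in Hb; apply (far_boundary b a); auto using adj_sym.
      * intros a b [H|H] Ha Hb; apply NNPP in Hb; [destruct (Hnf a b H); tauto|].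
        destruct H as [H|[-> ->]]; [auto|destruct Ha; apply far_p].
    + exists far, split_pending; split; [apply far_p|].
      split; [apply not_far_x|split; [|split]].
      * exact split_rep_far_iff.
      * intros a b Hab Ha Hb; apply (far_boundary a b); auto.
      * intros a b [H|H] Ha Hb; [destruct (Hnf a b H); tauto|].
        destruct H as [[-> ->]|H]; [destruct Hb; apply far_p|auto].
Defined.

Lemma split_tree_le : pt_le s split_tree.
Proof.
  split; [left; auto|split; [exact split_rep_fixed|split; [exact split_rep_refines|]]].
  intros a b [H|[[-> ->]|[-> ->]]]; [auto| |]; right; rewrite rep_p; auto.
Qed.

End Split.

(** * Absorbing vertices *)

Lemma absorb_path (l : list V) :
  finitely_separable G ->
  forall (s : ptree) (x : V), pt_rep s x = x -> NoDup (x :: l) ->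
  rpath G (adj G) x l -> (forall q, In q l -> pt_rep s q = x) ->
  exists s', pt_le s s' /\ pt_rep s' (last l x) = last l x.
Proof.
  intros Hfs; induction l as [|p l IH]; intros s x Hx Hnd Hp Hin.
  - exists s; split; [apply pt_le_refl|exact Hx].
  - destruct Hp as [Hxp Hp]; apply NoDup_cons_iff in Hnd as [Hn Hnd].
    destruct (separate_from_list x (p :: l) Hfs) as [F HF].
    { intros q Hq E; subst; contradiction. }
    pose (s1 := split_tree s x p l F Hx Hxp Hin HF).
    (* The rest of the path lies in [far], now the class of [p], so the induction continues from
       [p]. *)
    assert (Hrep : forall q, In q (p :: l) -> pt_rep s1 q = p).
    { intros q Hq; apply split_rep_far, (far_path s x p l F); auto. }
    destruct (IH s1 p) as (s' & Hle & Hs'); auto.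
    { apply Hrep; left; auto. }
    { intros q Hq; apply Hrep; right; auto. }
    exists s'; rewrite last_cons; split; [|exact Hs'].
    eapply pt_le_trans; [|exact Hle]; apply split_tree_le.
Qed.

Lemma absorb_vertex (s : ptree) (w : V) :
  finitely_separable G -> exists s', pt_le s s' /\ pt_rep s' w = w.
Proof.
  intros Hfs; pose proof (pt_class G r s w) as Hcl.
  apply clos_rt_sym in Hcl; [|intros a b []; split; auto using adj_sym].
  destruct (clos_rt_simple_path G _ _ _ Hcl) as (l & Hp & Hl & Hnd).
  destruct (absorb_path l Hfs s (pt_rep s w)) as (s' & Hle & Hs'); auto.
  - apply pt_idem.
  - eapply rpath_mono; [|exact Hp]; simpl; tauto.
  - refine (rpath_in_invariant G _ (fun q => pt_rep s q = pt_rep s w) l _ _ _ Hp);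
      [|apply pt_idem].
    intros a b [_ E] Ha; congruence.
  - exists s'; rewrite Hl in Hs'; auto.
Qed.

Lemma absorb_list (l : list V) (s : ptree) :
  finitely_separable G ->
  exists s', pt_le s s' /\ forall w, In w l -> pt_rep s' w = w.
Proof.
  intros Hfs; revert s; induction l as [|v l IH]; intros s.
  - exists s; split; [apply pt_le_refl|intros w []].
  - destruct (absorb_vertex s v Hfs) as (s1 & H1 & Hv).
    destruct (IH s1) as (s2 & H2 & Hl).
    exists s2; split; [eapply pt_le_trans; eauto|].
    intros w [<-|Hw]; [apply H2; auto|auto].
Qed.

Lemma absorb_pending (s : ptree) :
  finitely_separable G ->
  exists s', pt_le s s' /\
    forall a b, In (a, b) (pt_pending s) -> pt_rep s' a = a /\ pt_rep s' b = b.
Proof.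
  intros Hfs.
  destruct (absorb_list (map fst (pt_pending s) ++ map snd (pt_pending s)) s Hfs)
    as (s' & Hle & H).
  exists s'; split; auto; intros a b Hab; split; apply H, in_or_app;
    [left|right]; [apply (in_map fst _ _ Hab)|apply (in_map snd _ _ Hab)].
Qed.

(** * Limits of chains of partial trees *)

Section Limit.
Variables (I : Type) (f : I -> ptree).
Hypothesis Hconn : connected G.
Hypothesis Hdir : forall i j, pt_le (f i) (f j) \/ pt_le (f j) (f i).
Notation limit_vertex w := (exists i, pt_rep (f i) w = w).
Hypothesis Habs : forall i a b, In (a, b) (pt_pending (f i)) ->
  limit_vertex a /\ limit_vertex b.

(* An edge separated at some stage ends up inside the limit, so walking from
   [w] until the limit is first met never changes the class at any stage. *)
Lemma limit_rep_exists (i0 : I) (w : V) :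
  exists u, limit_vertex u /\
    clos_refl_trans V
      (fun a b => adj G a b /\ forall i, pt_rep (f i) a = pt_rep (f i) b) w u.
Proof.
  pose proof (Hconn w r) as H; apply clos_rt_rt1n in H.
  remember r as r' eqn:Er in H; induction H as [w|w w1 r' Hadj _ IH].
  - exists w; split; [exists i0; subst; apply pt_root|apply rt_refl].
  - destruct (classic (limit_vertex w)) as [Hw|Hw]; [exists w; split; [auto|apply rt_refl]|].
    destruct (IH Er) as (u & Hu & Hp); exists u; split; auto.
    eapply rt_trans; [apply rt_step; split; [exact Hadj|]|exact Hp].
    intros i; apply NNPP; intros E; apply Hw.
    destruct (pt_cross G r (f i) w w1 Hadj E) as [[E' _]|E']; [eauto|].
    apply (Habs i w w1 E').
Qed.

(** At the later of two stages both vertices are fixed, so equal classes force equality. *)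
Lemma limit_vertex_separated (u v : V) :
  limit_vertex u -> limit_vertex v ->
  (forall i, pt_rep (f i) u = pt_rep (f i) v) -> u = v.
Proof.
  intros [i Hi] [j Hj] E; destruct (Hdir i j) as [H|H].
  - apply (proj1 (proj2 H)) in Hi; rewrite <- Hi, <- Hj; apply E.
  - apply (proj1 (proj2 H)) in Hj; rewrite <- Hi, <- Hj; apply E.
Qed.

Lemma limit_tree (i0 : I) :
  exists s : ptree, pt_pending s = [] /\
    (forall a b, pt_edge s a b <-> exists i, pt_edge (f i) a b) /\
    (forall i w, pt_rep (f i) w = w -> pt_rep s w = w).
Proof.
  (* The representative of [w] is the limit vertex sharing its class at every stage;
     [limit_vertex_separated] makes it unique. *)
  pose (c := fun w => proj1_sig (constructive_indefinite_description _ (limit_rep_exists i0 w))).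
  assert (Hlim : forall w, limit_vertex (c w)).
  { intros w; exact (proj1 (proj2_sig (constructive_indefinite_description _ (limit_rep_exists i0 w)))). }
  assert (Hpath : forall w, clos_refl_trans V
      (fun a b => adj G a b /\ forall i, pt_rep (f i) a = pt_rep (f i) b) w (c w)).
  { intros w; exact (proj2 (proj2_sig (constructive_indefinite_description _ (limit_rep_exists i0 w)))). }
  clearbody c.
  assert (Hrep : forall w i, pt_rep (f i) w = pt_rep (f i) (c w)).
  { intros w i; refine (clos_rt_invariant G _ (fun v => pt_rep (f i) w = pt_rep (f i) v)
      _ _ _ (Hpath w) eq_refl).
    intros a b [_ E] Ha; rewrite Ha; apply E. }
  assert (Heq : forall a b, (forall i, pt_rep (f i) a = pt_rep (f i) b) -> c a = c b).
  { intros a b E; apply limit_vertex_separated; auto.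
    intros i; rewrite <- !Hrep; apply E. }
  assert (Hfix : forall w, limit_vertex w -> c w = w).
  { intros w Hw; apply limit_vertex_separated; auto; intros i; now rewrite <- Hrep. }
  assert (Href : forall a b i, c a = c b -> pt_rep (f i) a = pt_rep (f i) b).
  { intros a b i E; rewrite (Hrep a), (Hrep b); now rewrite E. }
  unshelve eexists (PartialTree G r (fun a b => exists i, pt_edge (f i) a b) c []
    _ _ _ _ _ _ _ _ _).
  - intros a b [i H]; exists i; now apply pt_sym.
  - intros a b [i H]; eapply pt_adj; eauto.
  - intros a b [i H]; apply Hfix; exists i; eapply pt_fix; eauto.
  - apply Hfix; exists i0; apply pt_root.
  - intros w Hw; destruct (Hlim w) as [i Hi]; rewrite Hw in Hi.
    eapply clos_rt_mono; [|exact (pt_conn G r (f i) w Hi)]; simpl; eauto.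
  - intros w; apply Hfix, Hlim.
  - intros w; eapply clos_rt_mono; [|exact (Hpath w)]; intros a b []; auto.
  - intros a b Hab E; left.
    (* Different limit classes are already separated at some stage; there the edge either joins tree
       vertices or is pending, and [Habs] covers the latter. *)
    assert (H : exists i, pt_rep (f i) a <> pt_rep (f i) b).
    { apply NNPP; intros Hn; apply E, Heq; intros i; apply NNPP; eauto. }
    destruct H as [i Hi].
    destruct (pt_cross G r (f i) a b Hab Hi) as [[]|H].
    + split; apply Hfix; eauto.
    + destruct (Habs i a b H); auto.
  - intros x y [i Hxy]; destruct (pt_cut G r (f i) x y Hxy) as (S & K & H1 & H2 & H3 & H4 & H5).
    exists S, K; split; [auto|split; [auto|split; [|split; [auto|]]]].
    + intros a b E; apply H3; auto.
    (* An edge added after stage [i] lies inside a class of stage [i], so it cannot cross [S]. *)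
    + intros a b [j Hab] Ha Hb; apply H5; auto.
      destruct (Hdir i j) as [H|H]; [|now apply H].
      destruct (proj2 (proj2 (proj2 H)) a b Hab) as [|E]; auto.
      destruct Hb; eauto.
  - simpl; split; [reflexivity|split; [tauto|eauto]].
Qed.

End Limit.

(** * Closed trees and maximality *)

Lemma pt_closure (s : ptree) :
  connected G -> finitely_separable G ->
  exists s' : ptree, pt_pending s' = [] /\
    (forall a b, pt_edge s a b -> pt_edge s' a b) /\
    (forall w, pt_rep s w = w -> pt_rep s' w = w).
Proof.
  intros Hc Hfs.
  assert (Hex : exists next : ptree -> ptree, forall s, pt_le s (next s) /\
    forall a b, In (a, b) (pt_pending s) ->
      pt_rep (next s) a = a /\ pt_rep (next s) b = b).
  { exists (fun s => proj1_sig (constructive_indefinite_description _ (absorb_pending s Hfs))).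
    intros s'.
    exact (proj2_sig (constructive_indefinite_description _ (absorb_pending s' Hfs))). }
  destruct Hex as [next Hnext].
  pose (f := fun n => Nat.iter n next s).
  assert (Hmono : forall k n, pt_le (f n) (f (k + n))).
  { induction k as [|k IH]; intros n; [apply pt_le_refl|].
    eapply pt_le_trans; [apply IH|apply (Hnext (f (k + n)))]. }
  destruct (limit_tree nat f Hc) as (s' & H1 & H2 & H3).
  - intros i j; destruct (PeanoNat.Nat.le_ge_cases i j) as [H|H]; [left|right].
    + replace j with ((j - i) + i) by lia; apply Hmono.
    + replace i with ((i - j) + j) by lia; apply Hmono.
  - intros i a b Hab; destruct (proj2 (Hnext (f i)) a b Hab); split; exists (S i); auto.
  - exact 0.
  - exists s'; split; [auto|split].
    + intros a b H; apply H2; exists 0; exact H.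
    + exact (H3 0).
Qed.

(** Once nothing is pending in [s], inclusion of edges decides the order, so Zorn's lemma can run on
    edge sets. *)
Lemma closed_edge_le (s s' : ptree) :
  pt_pending s = [] ->
  (forall a b, pt_edge s a b -> pt_edge s' a b) -> pt_le s s'.
Proof.
  intros Hs Hsub.
  assert (Hfix : forall w, pt_rep s w = w -> pt_rep s' w = w).
  { intros w Hw; apply pt_edge_rep_fixed.
    eapply clos_rt_mono; [exact Hsub|now apply pt_conn]. }
  assert (Hcross : forall a b, adj G a b -> pt_rep s a <> pt_rep s b ->
                     pt_rep s a = a /\ pt_rep s b = b).
  { intros a b Hab E; destruct (pt_cross G r s a b Hab E) as [H|H]; auto.
    rewrite Hs in H; destruct H. }
  split; [auto|split; [auto|split]].
  (* An edge inside a class of [s'] that crossed classes of [s] would have both ends fixed by [s'],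
     so they would coincide. *)
  - assert (H : forall w, pt_rep s w = pt_rep s (pt_rep s' w)).
    { intros w; refine (clos_rt_invariant G _ (fun v => pt_rep s w = pt_rep s v)
        _ _ _ (pt_class G r s' w) eq_refl).
      intros a b [Hab E] Ha; rewrite Ha; apply NNPP; intros Hn.
      destruct (Hcross a b Hab Hn) as [Fa Fb]; apply Hn.
      apply Hfix in Fa; apply Hfix in Fb; congruence. }
    intros a b E; rewrite (H a), (H b); now rewrite E.
  (* A new edge [ab] across classes of [s] has its ends joined in the tree of [s]; that path would
     cross the cut of [ab] by an edge other than [ab]. *)
  - intros a b Hab; apply NNPP; intros Hn.
    destruct (Hcross a b (pt_adj G r s' a b Hab)) as [Fa Fb]; [tauto|].
    destruct (pt_cut G r s' a b Hab) as (S & K & H1 & H2 & _ & _ & H5).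
    apply H2; refine (clos_rt_invariant G (pt_edge s) S a b _ _ H1).
    + intros u v Huv Su; apply NNPP; intros Sv.
      destruct (H5 u v (Hsub u v Huv) Su Sv) as [-> ->]; tauto.
    + eapply rt_trans; [apply clos_rt_sym; [apply pt_sym|]|]; apply pt_conn; eauto.
Qed.

(** Bounds the empty chain in Zorn's lemma. *)
Definition root_tree : connected G -> ptree.
Proof.
  intros Hc.
  refine (PartialTree G r (fun _ _ => False) (fun _ => r) [] _ _ _ _ _ _ _ _ _);
    try contradiction; auto.
  - intros w <-; apply rt_refl.
  - intros w; eapply clos_rt_mono; [|exact (Hc w r)]; auto.
Defined.

Lemma spanning_partial_tree :
  connected G -> finitely_separable G ->
  exists s : ptree, forall w, pt_rep s w = w.
Proof.
  intros Hc Hfs.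
  pose (P := fun A : V * V -> Prop =>
    exists s : ptree, pt_pending s = [] /\ forall a b, A (a, b) <-> pt_edge s a b).
  destruct (@classical_sets.Zorn_bigcup (V * V)%type P) as (A & (s & Hs & HA) & Hmax).
  - intros Fam HFam Htot.
    destruct (classic (exists A, Fam A)) as [[A0 HA0]|Hemp].
    + pose (I := {A | Fam A}).
      pose (f := fun i : I =>
        proj1_sig (constructive_indefinite_description _ (HFam (proj1_sig i) (proj2_sig i)))).
      assert (Hf : forall i : I, pt_pending (f i) = [] /\
                     forall a b, proj1_sig i (a, b) <-> pt_edge (f i) a b).
      { intros i; exact (proj2_sig (constructive_indefinite_description _
          (HFam (proj1_sig i) (proj2_sig i)))). }
      clearbody f.
      destruct (limit_tree I f Hc) as (s & H1 & H2 & _).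
      * intros i j; destruct (Htot _ _ (proj2_sig i) (proj2_sig j)) as [H|H];
          [left|right]; apply closed_edge_le; try apply Hf;
          intros a b Hab; apply Hf, H, Hf, Hab.
      * intros i a b H; rewrite (proj1 (Hf i)) in H; destruct H.
      * exact (exist _ A0 HA0).
      * exists s; split; auto; intros a b; rewrite H2; split.
        -- intros [A HA Hab]; exists (exist _ A HA); now apply Hf.
        -- intros [i Hi]; exists (proj1_sig i); [apply (proj2_sig i)|now apply Hf].
    + exists (root_tree Hc); split; [reflexivity|]; simpl; intros a b; split; [|tauto].
      intros [A HA _]; eauto.
  - exists s; intros w; apply NNPP; intros Hw.
    destruct (absorb_vertex s w Hfs) as (s1 & Hle & Hw1).
    destruct (pt_closure s1 Hc Hfs) as (s2 & H1 & H2 & H3).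
    apply (Hmax (fun e => pt_edge s2 (fst e) (snd e))).
    + split.
      * intros [a b] H; simpl; apply H2, Hle, HA, H.
      (* The enlarged tree joins [r] to [w]; without new edges [w] would already be fixed by [s]. *)
      * intros H; apply Hw, pt_edge_rep_fixed.
        eapply clos_rt_mono; [|exact (pt_conn G r s2 w (H3 w Hw1))].
        intros a b Hab; apply HA, H; exact Hab.
    + exists s2; split; [auto|simpl; tauto].
Qed.

(** * Acyclicity, finite fundamental cuts and the equivalence *)

(** The rest of a cycle would cross the cut of its closing edge a second time, against [pt_cut]. *)
Lemma partial_tree_acyclic (s : ptree) : ~ has_cycle G (pt_edge s).
Proof.
  intros (x & l & Hlen & Hnd & Hp & Hlast).
  destruct (pt_cut G r s _ _ Hlast) as (S & K & H1 & H2 & _ & _ & H5).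
  destruct l as [|p l]; [simpl in Hlen; lia|].
  rewrite last_cons in *; destruct Hp as [Hxp Hp].
  apply NoDup_cons_iff in Hnd as [Hx Hnd].
  destruct (classic (S p)) as [Sp|Sp].
  (* The edge [px] would be the closing edge, making [p] also the last vertex, against [NoDup]. *)
  - destruct (H5 p x (pt_sym G r s _ _ Hxp) Sp H2) as [E _].
    destruct l as [|q l]; [simpl in Hlen; lia|].
    apply NoDup_cons_iff in Hnd as [Hn _]; apply Hn; rewrite E, last_cons.
    clear; revert q; induction l as [|z l IH]; intros q; [left; auto|].
    rewrite last_cons; right; apply IH.
  - destruct (rpath_crossing G (pt_edge s) S l p Hp Sp H1) as (a & b & Ha & Hab & Sa & Sb).
    destruct (H5 b a (pt_sym G r s _ _ Hab) Sb Sa) as [_ ->]; contradiction.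
Qed.

(** Without [xy] the component of [x] stays inside [S] and that of [y] outside, so [K] contains the
    fundamental cut. *)
Lemma partial_tree_finitely_separating (s : ptree) : finitely_separating G (pt_edge s).
Proof.
  intros x y Hxy; destruct (pt_cut G r s x y Hxy) as (S & K & H1 & H2 & _ & H4 & H5).
  exists K; intros a b Hab Ha Hb; apply H4; auto.
  - refine (clos_rt_invariant G _ S _ _ _ Ha H1).
    intros u v [Huv Hn] Su; apply NNPP; intros Sv; apply Hn; left; auto.
  - refine (clos_rt_invariant G _ (fun w => ~ S w) _ _ _ Hb H2).
    intros u v [Huv Hn] Su Sv; apply Hn; right.
    destruct (H5 v u (pt_sym G r s u v Huv) Sv Su); auto.
Qed.

End PartialTrees.

Theorem theorem2p2 (G : graph) :
  connected G ->
  (finitely_separable G <->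
   exists t : vert G -> vert G -> Prop,
     spanning_tree G t /\ finitely_separating G t).
Proof.
  intros Hc; split.
  - intros Hfs; destruct (classic (inhabited (vert G))) as [[r]|Hemp].
    + destruct (spanning_partial_tree G r Hc Hfs) as [s Hs].
      exists (pt_edge s); split; [|apply partial_tree_finitely_separating].
      split; [apply pt_sym|split; [apply pt_adj|split; [|apply partial_tree_acyclic]]].
      intros u v; eapply rt_trans; [apply clos_rt_sym; [apply pt_sym|]|];
        apply pt_conn; apply Hs.
    (* The empty graph has no root; the empty relation is its spanning tree. *)
    + exists (fun _ _ => False); split; [|intros x y []].
      split; [tauto|split; [tauto|split]].
      * intros u; destruct Hemp; exact (inhabits u).
      * intros [x _]; destruct Hemp; exact (inhabits x).
  - intros (t & Ht & Hf); eapply finitely_separating_separable; eauto.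
Qed.
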